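(* Let $G$ be a non-trivial finite group. Then $$c(G)=\sum_{\emptyset\neq I\subset \max(G)}\frac{(-1)^{|I|+1}}{1-\nu(\mathcal{H}_I^{\sharp})},$$ and $$c_2(G)=\sum_{\emptyset\neq I\subset \max(G)}\frac{(-1)^{|I|}}{1-\nu(\mathcal{H}_I^{\sharp})}\Bigl(1-\frac{2}{1-\nu(\mathcal{H}_I^{\sharp})}\Bigr)=\sum_{\emptyset\neq I\subset \max(G)}(-1)^{|I|+1}\frac{1+\nu(\mathcal{H}_I^{\sharp})}{(1-\nu(\mathcal{H}_I^{\sharp}))^2}.$$
   Context: For a finite group $G$, a tuple $(C_1,\ldots,C_m)$ of conjugacy classes of $G$ is said to generate $G$ if, for every choice of representatives $g_i\in C_i$ ($1\leq i\leq m$), the elements $g_1,\ldots,g_m$ generate $G$. Let $(X_n)_{n\geq 1}$ be a sequence of independent, uniformly distributed $G$-valued random variables and let $X_n^{\sharp}$ be the conjugacy class of $X_n$. Put $$\tau_G=\min\{n\geq 1 \mid (X_1^{\sharp},\ldots,X_n^{\sharp})\text{ generates } G\}\in[1,+\infty],\qquad c(G)=\mathbf{E}(\tau_G),\qquad c_2(G)=\mathbf{E}(\tau_G^2).$$ $\max(G)$ denotes the set of conjugacy classes of (proper) maximal subgroups of $G$. For $\mathcal{H}\in\max(G)$, $\mathcal{H}^{\sharp}$ is the set of conjugacy classes $C$ of $G$ such that $C\cap H_1\neq\emptyset$ for some subgroup $H_1$ in the conjugacy class $\mathcal{H}$. For a non-empty $I\subset\max(G)$, $\mathcal{H}_I^{\sharp}=\bigcap_{\mathcal{H}\in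 I}\mathcal{H}^{\sharp}$. For a set $C$ of conjugacy classes of $G$, $\nu(C)=|\tilde C|/|G|$, where $\tilde C\subset G$ is the union of the conjugacy classes in $C$. *)

(* Defs.v *)
From HB Require Import structures.
From mathcomp Require Import all_boot all_order all_algebra all_fingroup all_solvable.
From mathcomp Require Import all_classical all_reals all_analysis.

Set Implicit Arguments.
Unset Strict Implicit.
Unset Printing Implicit Defensive.

Import Order.TTheory GRing.Theory Num.Theory.

Section ConjugacyClasses.
Context {gT : finGroupType}.
Implicit Type G : {group gT}.
Local Open Scope group_scope.

(* Only meaningful when every C i is a conjugacy class of G. *)
Definition generates G (m : nat) (C : 'I_m -> {set gT}) : Prop :=
  forall g : 'I_m -> gT, (forall i, g i \in C i) ->
    <<[set g i | i : 'I_m]%SET>> = G.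

Definition max_classes G : {set {set {group gT}}} :=
  [set orbit 'JG%act G H | H : {group gT} & maximal H G]%SET.

Definition class_sharp G (H : {set {group gT}}) : {set {set gT}} :=
  [set C in classes G |
    [exists H1 : {group gT}, (H1 \in H) && (C :&: H1 != finset.set0)]]%SET.

(* Only used for I nonempty (the empty intersection would be the full type). *)
Definition sharp_inter G (I : {set {set {group gT}}}) : {set {set gT}} :=
  (\bigcap_(H in I) class_sharp G H)%SET.

Definition nu (R : realType) G (C : {set {set gT}}) : R :=
  (#|finset.cover C|%:R / #|G|%:R)%R.

End ConjugacyClasses.
Arguments nu {gT} R G C.

Local Open Scope classical_set_scope.
Local Open Scope ring_scope.
Local Open Scope ereal_scope.

Section Probability.
Context {d : measure_display} {Omega : measurableType d} {R : realType}.
Variable P : probability Omega R.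
Context {gT : finGroupType}.
Implicit Types (G : {group gT}) (X : nat -> Omega -> gT).

(* gT carries the discrete sigma-algebra: every subset A is measurable. *)
Definition mutually_independent X : Prop :=
  forall (s : seq nat) (A : nat -> set gT), uniq s ->
    P (\bigcap_(i in [set` s]) X i @^-1` A i)
    = \prod_(i <- s) P (X i @^-1` A i).

Definition iid_uniform G X : Prop :=
  [/\ forall n (A : set gT), measurable (X n @^-1` A),
      forall n w, X n w \in G,
      forall n (g : gT), g \in G ->
        P (X n @^-1` [set g]) = ((#|G|%:R)^-1)%:E
    & mutually_independent X].

(* The sequence is indexed from 0, so that the first n variables are
   X 0, ..., X (n - 1). The infimum of the empty set is +oo. *)
Definition tau G X (w : Omega) : \bar R :=
  ereal_inf [set (n%:R)%:E | n in
    [set n : nat | (1 <= n)%N /\ generates G (fun i : 'I_n => (X i w ^: G)%g)]].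

Definition chebotarev G X : \bar R := \int[P]_w tau G X w.

Definition chebotarev2 G X : \bar R := \int[P]_w (tau G X w ^+ 2).

End Probability.

(* Main.v *)
(* The classes of X_0, ..., X_(n-1) fail to generate G exactly when some class
   of maximal subgroups meets all of them. Inclusion-exclusion over max(G) and
   independence therefore give
     P(tau > n) = \sum_(I != 0) (-1)^(|I|+1) nu(H_I^#)^n,
   and E(tau) and E(tau^2) are obtained by summing this against 1 and 2n+1.
   The series converge since nu(H_I^#) < 1, because the conjugates of a proper
   subgroup do not cover G. *)
Require Import Defs.
From mathcomp Require Import all_boot all_order all_algebra all_fingroup all_solvable.
From mathcomp Require Import all_classical all_reals all_analysis.
From mathcomp Require Import measurable_realfun ring.
Set Implicit Arguments.
Unset Strict Implicit.
Unset Printing Implicit Defensive.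
Import Order.TTheory GRing.Theory Num.Theory.
Import numFieldNormedType.Exports.
Local Open Scope ring_scope.

(** * Inclusion-exclusion for Boolean indicators *)

Lemma inclusion_exclusion (R : comPzRingType) (T : finType) (M : {set T})
    (p : pred T) :
  [exists x in M, p x]%:R =
  \sum_(I : {set T} | (I != finset.set0) && (I \subset M))
     (-1) ^+ #|I|.+1 * [forall x in I, p x]%:R :> R.
Proof.
(* Both sides come from expanding the product of 1 - p x over x in M. *)
have expand : \prod_x ((if x \in M then - (p x)%:R else 0) + 1) =
    \sum_(I : {set T} | I \subset M)
      (-1) ^+ #|I| * [forall x in I, p x]%:R :> R.
  rewrite bigA_distr [RHS]big_mkcond; apply: eq_bigr => I _.
  rewrite -big_mkcond /=; case: ifPn => [/fintype.subsetP IM|].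
    rewrite (eq_bigr (fun x => -1 * (p x)%:R)) => [|x xI]; last first.
      by rewrite IM// mulN1r.
    rewrite big_split prodr_const; congr (_ * _).
    case: (boolP [forall x in I, p x]) => [/forall_inP pI|].
      by rewrite big1// => x /pI ->.
    rewrite negb_forall_in => /exists_inP[x xI /negbTE px].
    by rewrite (bigD1 x)//= px mul0r.
  by case/subsetPn => x xI xM; rewrite (bigD1 x)//= (negbTE xM) mul0r.
have prodE : \prod_x ((if x \in M then - (p x)%:R else 0) + 1) =
    1 - [exists x in M, p x]%:R :> R.
  case: (boolP [exists x in M, p x]) => [/exists_inP[x xM px]|].
    by rewrite (bigD1 x)//= xM px addNr mul0r subrr.
  rewrite negb_exists_in => /forall_inP pM.
  rewrite subr0 big1// => x _; case: ifPn => [/pM/negbTE->|_].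
    by rewrite oppr0 add0r.
  by rewrite add0r.
(* The term of the empty set equals 1 and cancels the constant 1 in [prodE]. *)
move: expand; rewrite prodE (bigD1 finset.set0) ?finset.sub0set//= cards0 expr0.
have -> : [forall x in finset.set0, p x] = true.
  by apply/forall_inP => x; rewrite inE.
rewrite mulr1 => /addrI/(congr1 -%R); rewrite opprK => ->.
rewrite -sumrN; apply: eq_big => [I|I _]; first by rewrite andbC.
by rewrite exprS mulN1r mulNr.
Qed.

(** * Maximal subgroups and the classes that meet them *)

Section Group.
Context {gT : finGroupType}.
Implicit Types (G H M : {group gT}) (I : {set {set {group gT}}}).
Local Open Scope group_scope.

(* Jordan's theorem: the |G : H| conjugates of H all share the identity. *)
Lemma card_class_support_ltn G H :
  H \proper G -> (#|class_support H G| < #|G|)%N.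
Proof.
move=> /[dup] /proper_sub sHG pHG.
(* [H] normalizes [H^#], so [H^#] has at most |G : H| conjugates under [G]. *)
have conjle : (#|H^# :^: G| <= #|G : H|)%N.
  rewrite card_conjugates dvdn_leq// indexgS// finset.subsetI sHG.
  by rewrite /= normD1 normG.
have card1 (B : {set gT}) : B \in H^# :^: G -> #|B| = (#|H|.-1)%N.
  by case/imsetP=> x _ ->; rewrite cardJg [in RHS](cardsD1 1) group1.
have := leq_card_cover (H^# :^: G); rewrite (eq_bigr _ card1) sum_nat_const.
move=> /leq_trans/(_ (leq_mul conjle (leqnn _))) cov.
rewrite (cardsD1 1) mem_class_support// class_supportD1 add1n.
apply: leq_ltn_trans (cov : _.+1 <= _.+1)%N _.
(* With |H| = h + 1 the claim is 1 + |G : H| h < |G : H| (h + 1), that is, |G : H| > 1. *)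
have := proper_subn pHG; rewrite -indexg_gt1 -(Lagrange sHG) => i1.
case: #|H| (cardG_gt0 H) => // h _.
by rewrite mulSn mulnC -[X in (X < _)%N]add1n ltn_add2r.
Qed.

(** [C] is stable under conjugation by [G], so it meets some [G]-conjugate of [M] exactly when it
    meets [M] itself. *)
Lemma class_sharp_maximal G M (C : {set gT}) : maximal M G -> C \in classes G ->
  (C \in class_sharp G (orbit 'JG%act G M)) = (C :&: M != finset.set0)%SET.
Proof.
move=> maxM CG; rewrite inE CG /=; apply/existsP/idP => [[H1 /andP[]]|CM].
  case/imsetP=> x xG -> {H1} /set0Pn[y]; rewrite inE => /andP[yC yM].
  apply/set0Pn; exists (y ^ x^-1).
  rewrite mem_conjg in yM; rewrite inE yM andbT.
  case/imsetP: CG yC => z zG -> /imsetP[u uG ->].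
  by rewrite -conjgM memJ_class// groupM// groupV.
by exists M; rewrite orbit_refl.
Qed.

(** Representatives that do not generate [G] lie in a maximal subgroup [M], which then meets every
    [C i]. Conversely, if [M] meets every [C i], representatives can all be chosen in this one [M],
    and they generate a proper subgroup. *)
Lemma generatesP G n (C : 'I_n -> {set gT}) : (forall i, C i \in classes G) ->
  reflect (generates G C)
    (~~ [exists H in max_classes G, [forall i, C i \in class_sharp G H]]).
Proof.
move=> CG; apply: (iffP idP).
  move=> nex g gC; apply/eqP; apply: contraNT nex => neG.
  have sG : <<[set g i | i : 'I_n]%SET>> \subset G.
    rewrite gen_subG; apply/fintype.subsetP => _ /imsetP[i _ ->].
    have := gC i; case/imsetP: (CG i) => x xG ->; apply/fintype.subsetP.
    by rewrite class_subG.
  case: (maximal_exists sG) => [eG|[M maxM sM]].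
    by case/eqP: neG.
  apply/exists_inP; exists (orbit 'JG%act G M).
    by apply/imsetP; exists M; rewrite ?inE.
  apply/forallP => i; rewrite class_sharp_maximal//.
  apply/set0Pn; exists (g i); rewrite inE gC (fintype.subsetP sM)// mem_gen//.
  exact: imset_f.
move=> gen; apply/exists_inP => -[_ /imsetP[M maxM ->] /forallP CM].
rewrite inE in maxM.
have /fin_all_exists[g gP] i : exists x, x \in C i :&: M.
  by apply/set0Pn; rewrite -(class_sharp_maximal maxM).
have : G \subset M.
  rewrite -(gen g) => [|i]; last by have := gP i; rewrite inE => /andP[].
  rewrite gen_subG; apply/fintype.subsetP => _ /imsetP[i _ ->].
  by have := gP i; rewrite inE => /andP[].
by apply/negP/proper_subn; case/maxgroupP: maxM.
Qed.

Lemma sub_sharp_inter_classes G I :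
  I != finset.set0 -> (sharp_inter G I \subset classes G)%SET.
Proof.
case/set0Pn => H HI; apply/fintype.subsetP => C /bigcapP/(_ H HI).
by rewrite inE => /andP[].
Qed.

(** The classes partition [G], so only [x ^: G] contains [x]; membership in the union becomes a
    condition on that one class. *)
Lemma mem_cover_sharp_inter G I x : I != finset.set0 -> x \in G ->
  (x \in finset.cover (sharp_inter G I)) =
  [forall H in I, x ^: G \in class_sharp G H].
Proof.
move=> I0 xG; apply/bigcupP/forall_inP => [[C CI xC] H HI|xI].
  have /imsetP[y yG Cy] := fintype.subsetP (sub_sharp_inter_classes G I0) C CI.
  have -> : x ^: G = C by rewrite Cy; apply/class_eqP; rewrite -Cy.
  by move/bigcapP: CI; apply.
by exists (x ^: G); [apply/bigcapP | exact: class_refl].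
Qed.

Lemma cover_sharp_inter_sub G I :
  I != finset.set0 -> finset.cover (sharp_inter G I) \subset G.
Proof.
move=> I0; apply/bigcupsP => C.
move=> /(fintype.subsetP (sub_sharp_inter_classes G I0)).
by case/imsetP=> x xG ->; rewrite class_subG.
Qed.

(** One member of [I] suffices: if it is the class of [M], every element of the union is conjugate
    into [M]. The union then lies in [class_support M G], which is smaller than [G] by Jordan's
    theorem. *)
Lemma card_cover_sharp_inter G I : I != finset.set0 -> I \subset max_classes G ->
  (#|finset.cover (sharp_inter G I)| < #|G|)%N.
Proof.
move=> I0 IM; have /set0Pn[H HI] := I0.
have /imsetP[M] := fintype.subsetP IM H HI; rewrite inE => maxM HM.
have pM : M \proper G by case/maxgroupP: maxM.
apply: leq_ltn_trans (card_class_support_ltn pM); apply: subset_leq_card.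
apply/fintype.subsetP => x xI.
have xG := fintype.subsetP (cover_sharp_inter_sub G I0) x xI.
move: xI; rewrite mem_cover_sharp_inter// => /forall_inP/(_ H HI).
rewrite HM class_sharp_maximal ?mem_classes//.
case/set0Pn => y; rewrite inE => /andP[/imsetP[z zG ->] xzM].
rewrite class_supportEr; apply/bigcupP; exists z^-1; rewrite ?groupV//.
by rewrite mem_conjgV.
Qed.

(** Serves to show that the empty family of classes does not generate [G]. *)
Lemma max_classes_neq0 G : G :!=: 1 -> max_classes G != finset.set0.
Proof.
move=> G1; have [eG|[M maxM _]] := maximal_exists (sub1G G).
  by rewrite -eG eqxx in G1.
apply/set0Pn; exists (orbit 'JG%act G M).
by apply/imsetP; exists M; rewrite ?inE.
Qed.

End Group.

Local Open Scope classical_set_scope.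

(** * Power series and telescoping sums *)

Section Series.
Context {R : realType}.

Lemma cvg_mulrn_expr (x : R) : 0 <= x < 1 ->
  (fun n => n%:R * x ^+ n) @ \oo --> (0 : R).
Proof.
(* With y = sqrt x, n y^n <= 1 + y + ... + y^(n-1) <= 1 / (1 - y),
   hence n x^n <= y^n / (1 - y). *)
case/andP=> x0 x1; pose y := Num.sqrt x.
have y0 : 0 <= y := sqrtr_ge0 x.
have y1 : y < 1 by rewrite -sqrtr1 ltr_sqrt.
have ny n : n%:R * y ^+ n <= (1 - y)^-1.
  have sumE : 1 - y ^+ n = (1 - y) * \sum_(i < n) y ^+ i.
    by rewrite -[LHS]opprB subrX1 -mulNr opprB.
  rewrite -[leRHS]div1r ler_pdivlMr ?subr_gt0// mulrC.
  apply: (@le_trans _ _ (1 - y ^+ n)); last by rewrite gerBl exprn_ge0.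
  rewrite sumE ler_wpM2l ?subr_ge0 ?(ltW y1)//.
  have -> : n%:R * y ^+ n = \sum_(i < n) y ^+ n.
    by rewrite sumr_const card_ord mulr_natl.
  apply: ler_sum => i _.
  by rewrite ler_wiXn2l ?(ltW y1) ?(ltnW (ltn_ord i)).
have ub n : 0 <= n%:R * x ^+ n <= geometric (1 - y)^-1 y n.
  rewrite mulr_ge0 ?exprn_ge0//= -(sqr_sqrtr x0) -exprM mulnC exprM expr2 mulrA.
  by rewrite ler_wpM2r// exprn_ge0.
apply: (@squeeze_cvgr _ _ _ _ (cst 0) (geometric (1 - y)^-1 y)).
- exact: nearW.
- exact: cvg_cst.
by apply: cvg_geometric; rewrite ger0_norm.
Qed.

Lemma cvg_odd_geometric_series (x : R) : 0 <= x < 1 ->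
  series (fun n => n.*2.+1%:R * x ^+ n) @ \oo --> (1 + x) / (1 - x) ^+ 2.
Proof.
move=> x01; have [x0 x1] := andP x01.
have x1' : 1 - x != 0 by rewrite subr_eq0 gt_eqF.
(* Closed form of the partial sums, checked by induction; both terms that depend on [n] tend to
   0. *)
have -> : series (fun n => n.*2.+1%:R * x ^+ n) = (fun n =>
    ((1 + x) - ((2 * (1 - x)) * (n%:R * x ^+ n) + (1 + x) * x ^+ n))
    / (1 - x) ^+ 2).
  apply/funext; elim=> [|n IH].
    by rewrite /series/= big_geq// expr0 mul0r mulr0 add0r mulr1 subrr mul0r.
  rewrite seriesSr IH (exprS x) -(natr1 n.*2) -muln2 natrM -(natr1 n).
  by field.
have -> : (1 + x) / (1 - x) ^+ 2 = ((1 + x) - 0) / (1 - x) ^+ 2.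
  by rewrite subr0.
apply: cvgMr_tmp; apply: cvgB; first exact: cvg_cst.
have -> : 0 = 2 * (1 - x) * 0 + (1 + x) * 0 :> R by rewrite !mulr0 addr0.
apply: cvgD; apply: cvgMl_tmp; first exact: cvg_mulrn_expr.
have -> : GRing.exp x = geometric 1 x by apply/funext => n /=; rewrite mul1r.
by apply: cvg_geometric; rewrite ger0_norm.
Qed.

(* a^(k+1) is the telescoping sum of (n+1)^(k+1) - n^(k+1) over n < a. *)
Lemma expe_ereal_inf_natE (b : pred nat) (k : nat) :
  b 0%N -> (forall n, b n.+1 -> b n) ->
  (ereal_inf [set n%:R%:E | n in [set n | ~~ b n]] ^+ k.+1 =
   \sum_(0 <= n <oo) ((n.+1 ^ k.+1 - n ^ k.+1) * b n)%:R%:E :> \bar R)%E.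
Proof.
move=> b0 bS.
have mono : {homo (fun n => n ^ k.+1)%N : m n / (m <= n)%N}.
  by move=> m n mn; rewrite leq_exp2r.
have tele m : (forall n, (n < m)%N -> b n) ->
    (\sum_(0 <= n < m) ((n.+1 ^ k.+1 - n ^ k.+1) * b n)%:R%:E =
     (m ^ k.+1)%:R%:E :> \bar R)%E.
  move=> bm; rewrite sumEFin -natr_sum; congr (_%:R%:E).
  rewrite -[RHS]subn0 -[X in (_ - X)%N](exp0n (ltn0Sn k)).
  rewrite -(telescope_sumn 0 m mono).
  by apply: eq_big_nat => n /= nm; rewrite bm// muln1.
(* If [b] fails somewhere, with least failure [m], then [b n] holds exactly for n < m and the series
   stops at [m]. Otherwise the infimum is over the empty set, and both sides are +oo. *)
case: (pselect (exists n, ~~ b n)) => [exb|nexb].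
  case: (ex_minnP exb) => m bm min_m.
  have bN n : ~~ b n -> (m <= n)%N by exact: min_m.
  have bup n : (m <= n)%N -> ~~ b n.
    elim: n => [|n IH]; first by rewrite leqn0 => /eqP <-.
    by rewrite leq_eqVlt => /predU1P[<-//|/IH]; apply: contra; exact: bS.
  have -> : ereal_inf [set n%:R%:E | n in [set n | ~~ b n]] = m%:R%:E :> \bar R.
    apply/eqP; rewrite eq_le; apply/andP; split.
      by apply: ereal_inf_lbound; exists m.
    by apply: le_ereal_inf_tmp => _ [n /= bn <-]; rewrite lee_fin ler_nat bN.
  rewrite (nneseries_split 0 m)//.
  rewrite add0n eseries0 => [|n mn _]; last first.
    by rewrite (negbTE (bup _ mn)) muln0.
  rewrite adde0 tele => [|n]; last by rewrite ltnNge; apply: contraNT => /bN.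
  by rewrite -EFin_expe natrX.
have bT n : b n by apply/negPn/negP => bn; apply: nexb; exists n.
rewrite [X in ereal_inf X](_ : _ = set0); last first.
  by apply/seteqP; split=> // y [n /= /negP].
rewrite ereal_inf0; transitivity (+oo : \bar R)%E.
  by elim: (k) => [//|j IH]; rewrite expeS IH mulyy.
apply/esym/eqyP => A A0.
(* The partial sum up to [m] is m^(k+1) >= m, so an integer above [A] gives a partial sum above
   [A]. *)
apply: le_trans (nneseries_lim_ge (Num.bound A) _); last first.
  by move=> n _ _; rewrite lee_fin ler0n.
rewrite tele// lee_fin (le_trans (ltW (archi_boundP (ltW A0))))// ler_nat.
by rewrite expnS leq_pmulr// expn_gt0.
Qed.

End Series.

(** * Exchange of integral, series and finite sum *)

Section Tails.
Context {d : measure_display} {Omega : measurableType d} {R : realType}.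
Variable P : probability Omega R.

(** The terms of the series are nonnegative, so integral and series commute. Each term is a finite
    signed combination of integrable indicators, so linearity evaluates its integral; the limit is
    then taken separately for each [j]. *)
Lemma integral_tail_series (J : finType) (Q : pred J) (c : nat -> nat)
    (b : nat -> Omega -> bool) (F : nat -> J -> set Omega) (s x L : J -> R) :
  (forall n j, measurable (F n j)) ->
  (forall n j, Q j -> P (F n j) = (x j ^+ n)%:E) ->
  (forall n w, (b n w)%:R = \sum_(j | Q j) s j * \1_(F n j) w) ->
  (forall j, Q j -> series (fun n => (c n)%:R * x j ^+ n) @ \oo --> L j) ->
  (\int[P]_w \sum_(0 <= n <oo) (c n * b n w)%:R%:E =
   (\sum_(j | Q j) s j * L j)%:E)%E.
Proof.
move=> mF PF bE cvgL.
have cbE n w : ((c n * b n w)%:R%:E =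
    \sum_(j | Q j) ((c n)%:R * s j)%:E * (\1_(F n j) w)%:E :> \bar R)%E.
  rewrite natrM bE mulr_sumr -sumEFin.
  by apply: eq_bigr => j _; rewrite -EFinM mulrA.
have intF n j : P.-integrable setT
    (fun w => ((c n)%:R * s j)%:E * (\1_(F n j) w)%:E)%E.
  by apply: integrableZl => //; exact: integrable_indic.
(* Measurability of [b n] is inherited from its expansion in indicators of measurable sets. *)
have mcb n : measurable_fun setT (fun w => (c n * b n w)%:R%:E : \bar R).
  under eq_fun do rewrite cbE -big_filter.
  by apply: emeasurable_sum => j _; exact: (measurable_int P (intF n j)).
rewrite integral_nneseries//.
have intE n : (\int[P]_w (c n * b n w)%:R%:E =
    (\sum_(j | Q j) s j * ((c n)%:R * x j ^+ n))%:E)%E.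
  under eq_integral do rewrite cbE.
  rewrite integral_sum// -sumEFin; apply: eq_bigr => j Qj.
  rewrite integralZl//; last exact: integrable_indic.
  rewrite integral_indic// setIT mulrCA mulrA [in RHS]EFinM.
  by congr (_ * _)%E; exact: PF.
under eq_eseriesr do rewrite intE.
apply: cvg_lim => //.
rewrite (_ : (fun n => _) = EFin \o
    (fun n => \sum_(j | Q j) s j * series (fun n => (c n)%:R * x j ^+ n) n)).
  apply: cvg_EFin; first by near=> n.
  apply: cvg_big => [|j Qj]; first exact: add_continuous.
  by apply: cvgMl_tmp; exact: cvgL.
apply/funext => n /=; rewrite sumEFin exchange_big/=; congr (_%:E).
by apply: eq_bigr => j _; rewrite /series/= mulr_sumr.
Unshelve. all: by end_near. Qed.

End Tails.

(** * Tails and moments of the waiting time *)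

Section Chebotarev.
Context {d : measure_display} {Omega : measurableType d} {R : realType}.
Variable P : probability Omega R.
Context {gT : finGroupType}.
Variables (G : {group gT}) (X : nat -> Omega -> gT).
Hypothesis X_iid : iid_uniform P G X.
Implicit Types I : {set {set {group gT}}}.

Let mX n (A : set gT) : measurable (X n @^-1` A).
Proof. by case: X_iid => + _ _ _; apply. Qed.

Let XG n w : X n w \in G.
Proof. by case: X_iid => _ + _ _; apply. Qed.

Lemma iid_uniform_preimage n (B : {set gT}) : B \subset G ->
  P (X n @^-1` [set` B]) = (#|B|%:R / #|G|%:R)%:E.
Proof.
case: X_iid => _ _ PX _ /fintype.subsetP BG.
have -> : X n @^-1` [set` B] = \bigcup_(g in [set` enum B]) X n @^-1` [set g].
  apply/seteqP; split=> w /=.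
    by move=> XB; exists (X n w) => //=; rewrite mem_enum.
  by case=> g /=; rewrite mem_enum => gB ->.
rewrite measure_fin_bigcup//; last 1 first.
  by move=> g h _ _ [w [/= -> ->]].
rewrite -fsbig_seq ?enum_uniq// big_enum/=.
rewrite (eq_bigr (fun=> (#|G|%:R^-1)%:E)) => [|g /BG]; last exact: PX.
by rewrite sumEFin sumr_const mulr_natl.
Qed.

(** Indexed by a duplicate-free list, the form in which [mutually_independent] applies. *)
Definition all_in_sharp I n : set Omega :=
  \bigcap_(i in [set` iota 0 n])
    X i @^-1` [set` finset.cover (sharp_inter G I)].

Lemma measurable_all_in_sharp I n : measurable (all_in_sharp I n).
Proof. by apply: bigcap_measurableType => i _; exact: mX. Qed.

Lemma probability_all_in_sharp I n : I != finset.set0 ->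
  P (all_in_sharp I n) = (nu R G (sharp_inter G I) ^+ n)%:E.
Proof.
move=> I0; case: X_iid => _ _ _ indep.
rewrite /all_in_sharp indep ?iota_uniq//.
rewrite (eq_bigr (fun=> (nu R G (sharp_inter G I))%:E)) => [|i _]; last first.
  by rewrite iid_uniform_preimage// cover_sharp_inter_sub.
rewrite prodEFin -[in iota 0 n](subn0 n) -/(index_iota 0 n).
by rewrite prodr_const_nat subn0.
Qed.

Definition not_generated n w :=
  [exists H in max_classes G,
     [forall i : 'I_n, (X i w ^: G)%g \in class_sharp G H]].

(** Inclusion-exclusion over [max_classes G], followed by exchanging the quantifiers over [H] in [I]
    and over i < n. *)
Lemma not_generatedE n w : (not_generated n w)%:R =
  \sum_(I : {set {set {group gT}}} |
         (I != finset.set0) && (I \subset max_classes G))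
     (-1) ^+ #|I|.+1 * \1_(all_in_sharp I n) w :> R.
Proof.
rewrite /not_generated inclusion_exclusion; apply: eq_bigr => I /andP[I0 _].
rewrite indicE; congr (_ * (nat_of_bool _)%:R).
apply/forall_inP/idP => [HI|]; last first.
  rewrite inE => wI H HI; apply/forallP => i.
  have := wI i; rewrite /= mem_iota ltn_ord => /(_ isT).
  by rewrite mem_cover_sharp_inter// => /forall_inP; apply.
rewrite inE => i /=; rewrite mem_iota add0n => /andP[_ lt_in].
rewrite mem_cover_sharp_inter//; apply/forall_inP => H /HI /forallP.
by move=> /(_ (Ordinal lt_in)).
Qed.

Lemma tauE w (k : nat) : (G :!=: 1)%g -> (tau G X w ^+ k.+1 =
  \sum_(0 <= n <oo) ((n.+1 ^ k.+1 - n ^ k.+1) * not_generated n w)%:R%:E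
    :> \bar R)%E.
Proof.
(* At n = 0 any class of maximal subgroups is a witness. Hence the condition 1 <= n in [tau] holds
   automatically. *)
move=> G1; have ng0 : not_generated 0 w.
  have /set0Pn[H HM] := max_classes_neq0 G1.
  by apply/exists_inP; exists H => //; apply/forallP => -[].
rewrite -expe_ereal_inf_natE//; last first.
  (* A class of maximal subgroups that meets the first n + 1 classes also meets the first [n]. *)
  move=> n /exists_inP[H HM /forallP ngH]; apply/exists_inP; exists H => //.
  by apply/forallP => i; exact: (ngH (widen_ord (leqnSn n) i)).
have gP n : reflect (generates G (fun i : 'I_n => (X i w ^: G)%g))
    (~~ not_generated n w).
  by apply: generatesP => i; exact: mem_classes.
congr (ereal_inf (image _ _) ^+ _)%E.
apply/seteqP; split=> n /=; first by case=> _ /gP.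
move=> ngn; split; last exact/gP.
by rewrite lt0n; apply: contraNneq ngn => ->.
Qed.

Lemma nu_ge0 I : 0 <= nu R G (sharp_inter G I).
Proof. by rewrite /nu divr_ge0. Qed.

Lemma nu_lt1 I : I != finset.set0 -> I \subset max_classes G ->
  nu R G (sharp_inter G I) < 1.
Proof.
move=> I0 IM; rewrite /nu ltr_pdivrMr ?ltr0n ?cardG_gt0// mul1r ltr_nat.
exact: card_cover_sharp_inter.
Qed.

(** Treats all positive moments at once: only the sum of the power series with coefficients
    (n+1)^(k+1) - n^(k+1) depends on [k]. *)
Lemma integral_tauX (k : nat) (L : {set {set {group gT}}} -> R) :
  (G :!=: 1)%g ->
  (forall I, I != finset.set0 -> I \subset max_classes G ->
     series (fun n => (n.+1 ^ k.+1 - n ^ k.+1)%:R *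
       nu R G (sharp_inter G I) ^+ n) @ \oo --> L I) ->
  (\int[P]_w (tau G X w ^+ k.+1) =
   (\sum_(I : {set {set {group gT}}} |
         (I != finset.set0) && (I \subset max_classes G))
       (-1) ^+ #|I|.+1 * L I)%:E)%E.
Proof.
move=> G1 cvgL; under eq_integral do rewrite tauE//.
apply: (integral_tail_series (F := fun n I => all_in_sharp I n)
  (x := fun I => nu R G (sharp_inter G I))) => [n I|n I|n w|I].
- exact: measurable_all_in_sharp.
- by case/andP => I0 _; exact: probability_all_in_sharp.
- exact: not_generatedE.
- by case/andP; exact: cvgL.
Qed.

End Chebotarev.

Local Close Scope classical_set_scope.

Theorem proposition2p7 (gT : finGroupType) (G : {group gT})
    (d : measure_display) (Omega : measurableType d) (R : realType)
    (P : probability Omega R) (X : nat -> Omega -> gT) :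
  (G :!=: 1)%g -> iid_uniform P G X ->
  [/\ chebotarev P G X =
      (\sum_(I : {set {set {group gT}}} |
              (I != finset.set0) && (I \subset max_classes G))
          (-1) ^+ #|I|.+1 / (1 - nu R G (sharp_inter G I)))%:E,
      chebotarev2 P G X =
      (\sum_(I : {set {set {group gT}}} |
              (I != finset.set0) && (I \subset max_classes G))
          (-1) ^+ #|I| / (1 - nu R G (sharp_inter G I))
          * (1 - 2 / (1 - nu R G (sharp_inter G I))))%:E
    & \sum_(I : {set {set {group gT}}} |
              (I != finset.set0) && (I \subset max_classes G))
          (-1) ^+ #|I| / (1 - nu R G (sharp_inter G I))
          * (1 - 2 / (1 - nu R G (sharp_inter G I)))
      = \sum_(I : {set {set {group gT}}} |
              (I != finset.set0) && (I \subset max_classes G))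
          (-1) ^+ #|I|.+1 * ((1 + nu R G (sharp_inter G I))
                             / (1 - nu R G (sharp_inter G I)) ^+ 2)].
Proof.
move=> G1 X_iid.
have nu1 I : I != finset.set0 -> I \subset max_classes G ->
    0 <= nu R G (sharp_inter G I) < 1.
  by move=> I0 IM; rewrite nu_ge0 nu_lt1.
have second_form I : (I != finset.set0) && (I \subset max_classes G) ->
    (-1) ^+ #|I| / (1 - nu R G (sharp_inter G I))
      * (1 - 2 / (1 - nu R G (sharp_inter G I)))
    = (-1) ^+ #|I|.+1 * ((1 + nu R G (sharp_inter G I))
                         / (1 - nu R G (sharp_inter G I)) ^+ 2).
  case/andP=> I0 IM; have /andP[_ lt1] := nu1 I I0 IM.
  have nz : 1 - nu R G (sharp_inter G I) != 0 by rewrite subr_eq0 gt_eqF.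
  (* The identity rests on 1 - 2 / (1 - x) = - (1 + x) / (1 - x); the sign is generalized to an
     arbitrary [e]. *)
  rewrite (exprS (-1) #|I|); move: (_ ^+ #|I|) (nu _ _ _) nz => e x nz.
  by field.
split; last exact: eq_bigr.
(* For the first moment all coefficients are 1, and the series is geometric. *)
- apply: (integral_tauX (k := 0) X_iid G1) => I I0 IM.
  have /andP[ge0 lt1] := nu1 I I0 IM.
  rewrite -div1r.
  rewrite (_ : (fun n => _) = geometric 1 (nu R G (sharp_inter G I))).
    by apply: cvg_geometric_series; rewrite ger0_norm.
  by apply/funext => n /=; rewrite !expn1 subSnn.
- rewrite (eq_bigr _ second_form).
  apply: (integral_tauX (k := 1) X_iid G1) => I I0 IM.
  rewrite (_ : (fun n => _) =
      fun n => n.*2.+1%:R * nu R G (sharp_inter G I) ^+ n).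
    exact: cvg_odd_geometric_series (nu1 I I0 IM).
  (* The coefficient (n+1)^2 - n^2 is 2n + 1. *)
  apply/funext => n; congr (_%:R * _).
  by rewrite subn_sqr subSnn mul1n addSn addnn.
Qed.
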